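(* Let $(P,g,\Phi)$ be a Carrollian $\mathbb{R}^\times$-bundle with a connection over an oriented $n$-dimensional manifold $M$, with $g$ of signature $(1,\ldots,1,0)$ and with Euler vector field $\Delta_P$ Killing for $g$, i.e. $\mathcal{L}_{\Delta_P}g=0$. Let $\theta$ be the connection one-form of $\Phi$ and let $\star$ be the Hodge star operator on $P$ associated with the Lorentzian metric $G=g-\theta\otimes\theta$. If $\xi\in\Omega^k(P)$ is homogeneous of weight $\lambda\in\mathbb{R}$, i.e. $\mathcal{L}_{\Delta_P}\xi=\lambda\,\xi$, then $\star\xi\in\Omega^{n+1-k}(P)$ is also homogeneous of weight $\lambda$, i.e. $\mathcal{L}_{\Delta_P}(\star\xi)=\lambda\,\star\xi$.
   Context: $\mathbb{R}^\times=\mathbb{R}\setminus\{0\}$ is the multiplicative group. Let $\pi:P\to M$ be a smooth principal $\mathbb{R}^\times$-bundle with $\dim M=n$, so $\dim P=n+1$. The Euler vector field $\Delta_P$ is the fundamental vector field of the action, i.e. the generator of $p\mapsto e^{s}\cdot p$, $s\in\mathbb{R}$; in local coordinates $(x^a,t)$ adapted to a trivialisation, $\Delta_P=t\,\partial_t$. It spans the sections of the vertical bundle $VP=\ker(d\pi)$. A Carrollian $\mathbb{R}^\times$-bundle is such a $P$ equipped with a degenerate metric $g$ (a smooth symmetric covariant 2-tensor) such that $\ker(g):=\{X\in\mathrm{Vect}(P) : g(X,-)=0\}$ equals the module of sections of $VP$. Here $g$ has signature $(1,\ldots,1,0)$, i.e. it is positive semi-definite of rank $n$. The connection $\Phi$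 is a principal $\mathbb{R}^\times$-connection, with connection one-form $\theta\in\Omega^1(P)$: a globally defined real-valued $\mathbb{R}^\times$-invariant one-form with $\theta(\Delta_P)=1$ (so $\mathcal{L}_{\Delta_P}\theta=0$); locally $\theta=t^{-1}dt+A_a(x)\,dx^a$. The tensor $G:=g-\theta\otimes\theta$ is a non-degenerate Lorentzian metric on $P$ of signature $(1,\ldots,1,-1)$. $M$ is oriented, and $P$ is given the orientation in which $e^1\wedge\cdots\wedge e^n\wedge\theta$ is positive whenever $\{e^a\}$ is a local oriented coframe of forms annihilating $\Delta_P$ (oriented via $M$). $\mathsf{Vol}_P$ denotes the corresponding metric volume form of $G$; when $g=\pi^*g_M$ for a metric $g_M$ on $M$ with volume form $\mathsf{Vol}_M$, it is $\mathsf{Vol}_P=(-1)^n\theta\wedge\mathsf{Vol}_M$. The Hodge star of $\xi\in\Omega^k(P)$ is the unique $(n+1-k)$-form $\star\xi$ with $\eta\wedge\star\xi=\langle\eta,\xi\rangle_G\,\mathsf{Vol}_P$ for all $\eta\in\Omega^k(P)$, where $\langle\cdot,\cdot\rangle_G$ is the pointwise inner product on $k$-forms induced by $G$. *)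

(* Defs.v *)
From HB Require Import structures.
From mathcomp Require Import all_boot all_order all_algebra fingroup perm.
From mathcomp Require Import all_classical all_reals all_analysis.
From mathcomp Require Import ring.

Set Implicit Arguments.
Unset Strict Implicit.
Unset Printing Implicit Defensive.

Import Order.TTheory GRing.Theory Num.Theory.
Import numFieldNormedType.Exports.

Local Open Scope classical_set_scope.
Local Open Scope ring_scope.

(* [Ck k f x]: [f] is of class C^k on some neighbourhood of [x]. *)
Fixpoint Ck (R : realType) (V : normedModType R) (k : nat) (f : V -> R) (x : V)
    : Prop :=
  if k is k'.+1 then
    (\forall y \near x, differentiable f y) /\
    (forall v : V, Ck k' (fun y => 'D_v f y) x)
  else \forall y \near x, {for y, continuous f}.

Definition smooth_at (R : realType) (V : normedModType R) (f : V -> R) (x : V)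
    : Prop :=
  forall k, Ck k f x.

Section CkTheory.
Variables (R : realType) (V : normedModType R).
Implicit Types (f g : V -> R) (x : V).

Lemma near_eq_differentiable f g x :
  (\near x, f x = g x) -> differentiable f x -> differentiable g x.
Proof.
move=> fg df.
have eqo : g \o shift x = cst (g x) + 'd f x +o_ 0 id.
  have /diff_locallyP [_ e] := df.
  apply/eqaddoP => _ /posnumP[e1].
  have /eqaddoP /(_ e1%:num (gt0 e1)) := e.
  apply: filter_app.
  have : \forall h \near 0, f (h + x) = g (h + x).
    move/nbhs0P: fg; apply: filterS => h; by rewrite addrC.
  apply: filter_app; near=> h => fgh.
  by rewrite /= -(nbhs_singleton fg) !fctE /= fgh.
have cd : continuous ('d f x) by have /diff_locallyP [] := df.
have e := @diff_unique _ _ _ g ('d f x) x cd eqo.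
by apply/diff_locallyP; rewrite e.
Unshelve. all: by end_near. Qed.

Lemma near_eq_Ck k f g x : (\near x, f x = g x) -> Ck k f x -> Ck k g x.
Proof.
elim: k f g x => [|k IH] f g x fg /=.
  apply: filterS2 (near_join fg) => y fgy cf.
  rewrite /prop_for /continuous_at -(nbhs_singleton fgy).
  apply: cvg_trans cf.
  by apply: near_eq_cvg; apply: filterS fgy => z ->.
move=> [df cDf]; split.
  by apply: filterS2 (near_join fg) df => y; exact: near_eq_differentiable.
move=> v; apply: IH (cDf v).
by apply: filterS (near_join fg) => y fgy; exact: near_eq_derive.
Qed.

Lemma CkS k f x : Ck k.+1 f x -> Ck k f x.
Proof.
elim: k f x => [|k IH] f x [df cDf].
  by apply: filterS df => y; exact: differentiable_continuous.
by split=> // v; exact: IH.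
Qed.

Lemma Ck0 k f x : Ck k f x -> Ck 0 f x.
Proof. by elim: k => // k IH /CkS. Qed.

Lemma Ck_cst k (a : R) x : Ck k (cst a) x.
Proof.
elim: k a => [|k IH] a /=; first by apply: nearW => y; exact: cvg_cst.
split; first by apply: nearW => y; exact: differentiable_cst.
move=> v; suff -> : (fun y => 'D_v (cst a) y) = cst (0 : R) by exact: IH.
by apply/funext => y; rewrite derive_cst.
Qed.

Lemma CkD k f g x : Ck k f x -> Ck k g x -> Ck k (f + g) x.
Proof.
elim: k f g => [|k IH] f g /=.
  by apply: filterS2 => y cf cg; exact: cvgD.
move=> [df cf] [dg cg]; split.
  by apply: filterS2 df dg => y; exact: differentiableD.
move=> v; apply: near_eq_Ck (IH _ _ (cf v) (cg v)).
apply: filterS2 df dg => y dfy dgy.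
by rewrite deriveD //; exact: diff_derivable.
Qed.

Lemma CkM k f g x : Ck k f x -> Ck k g x -> Ck k (f * g) x.
Proof.
elim: k f g => [|k IH] f g; first by apply: filterS2 => y cf cg; exact: cvgM.
move=> cf cg; have [cf' cg'] := (CkS cf, CkS cg).
case: cf => df cf; case: cg => dg cg; split.
  by apply: filterS2 df dg => y; exact: differentiableM.
move=> v.
apply: near_eq_Ck (CkD (IH _ _ cf' (cg v)) (IH _ _ cg' (cf v))).
apply: filterS2 df dg => y dfy dgy.
by rewrite deriveM //; exact: diff_derivable.
Qed.

Lemma Ck_sum k n (h : 'I_n -> V -> R) x :
  (forall i, Ck k (h i) x) -> Ck k (\sum_i h i) x.
Proof.
move=> ch; elim/big_ind: _ => // [|f g]; last exact: CkD.
exact: Ck_cst.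
Qed.

End CkTheory.

Section CkComp.
Variables (R : realType) (V : normedModType R) (m : nat).
Implicit Types (f : 'rV[R]_m -> R) (g : V -> 'rV[R]_m) (x : V).

Let row_sum g : g = \sum_(j < m) (fun x => g x 0 j *: delta_mx 0 j).
Proof. by apply/funext => x; rewrite fct_sumE [LHS]row_sum_delta. Qed.

Lemma continuous_row g x :
  (forall j, {for x, continuous (fun y => g y 0 j)}) -> {for x, continuous g}.
Proof.
move=> cg; rewrite (row_sum g) /prop_for /continuous_at fct_sumE.
apply: cvg_big => [|j _]; first exact: add_continuous.
by apply: cvgZr_tmp; exact: cg.
Qed.

Lemma differentiable_row g x :
  (forall j, differentiable (fun y => g y 0 j) x) -> differentiable g x.
Proof.
move=> dg; rewrite (row_sum g); apply: differentiable_sum => j.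
exact: differentiableZl.
Qed.

Lemma derive_row g x v : differentiable g x ->
  'd g x v = \sum_(j < m) 'D_v (fun y => g y 0 j) x *: delta_mx 0 j.
Proof.
move=> dg; have dc j : differentiable (fun y => g y 0 j) x.
  apply: (@differentiable_comp _ _ _ _ g (fun N : 'rV[R]_m => N 0 j)) => //.
  exact: differentiable_coord.
rewrite -deriveE // [in LHS](row_sum g) derive_sum; last first.
  by move=> j; apply: diff_derivable; exact: differentiableZl.
apply: eq_bigr => j _.
by rewrite deriveE ?diffZl ?deriveE //; exact: differentiableZl.
Qed.

Lemma Ck_comp k f g x : Ck k f (g x) ->
  (forall j, Ck k (fun y => g y 0 j) x) -> Ck k (f \o g) x.
Proof.
elim: k f g x => [|k IH] f g x.
  move=> cf cg; have cgx : {for x, continuous g}.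
    by apply: continuous_row => j; exact: (nbhs_singleton (cg j)).
  have cg' : \forall y \near x, forall j, {for y, continuous (fun y => g y 0 j)}.
    exact: filter_forall.
  have cf' : \forall y \near x, {for g y, continuous f} by exact: cgx _ cf.
  apply: filterS2 cf' cg' => y cfy cgy.
  by apply: (@continuous_comp _ _ _ g f) cfy; exact: continuous_row.
move=> cf cg.
have cg' j := CkS (cg j); have cgx : {for x, continuous g}.
  by apply: continuous_row => j; have /Ck0/nbhs_singleton := cg j.
case: cf => df cf.
have dg : \forall y \near x, differentiable g y.
  have : \forall y \near x, forall j, differentiable (fun y => g y 0 j) y.
    by apply: filter_forall => j; case: (cg j).
  by apply: filterS => y; exact: differentiable_row.
have dfg : \forall y \near x, differentiable f (g y) by exact: cgx _ df.
split; first by apply: filterS2 dfg dg => y dfy dgy; exact: differentiable_comp.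
move=> v.
apply: (@near_eq_Ck _ _ _ (\sum_(j < m)
   (fun y => 'D_v (fun z => g z 0 j) y) * (('D_(delta_mx 0 j) f) \o g))).
  apply: filterS2 dfg dg => y dfy dgy.
  have dc : differentiable (f \o g) y by exact: differentiable_comp.
  rewrite (deriveE v dc) (diff_comp dgy dfy) /= derive_row // fct_sumE.
  rewrite linear_sum; apply: eq_bigr => j _.
  by rewrite linearZ -(deriveE _ dfy).
apply: Ck_sum => j; apply: CkM; first by case: (cg j) => _; exact.
by apply: IH; [exact: cf|exact: cg'].
Qed.

End CkComp.

Lemma Ck_slice (R : realType) (V : normedModType R) k (f : R * V -> R) a x :
  Ck k f (a, x) -> Ck k (fun y => f (a, y)) x.
Proof.
have cp y : {for y, continuous (fun y : V => (a, y))}.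
  apply: (@cvg_pair _ _ _ _ (nbhs a) (nbhs y)); first exact: cvg_cst.
  exact: cvg_id.
elim: k f x => [|k IH] f x.
  move=> cf; have : \forall y \near x, {for (a, y), continuous f} by exact: cp cf.
  by apply: filterS => y /(continuous_comp (cp y)).
have dp (y : V) : is_diff y (fun y : V => (a, y)) (fun y => (0, y)).
  exact: is_diff_pair.
have dp' (y : V) : differentiable (fun y : V => (a, y)) y by [].
move=> [df cf].
have df' : \forall y \near x, differentiable f (a, y) by exact: cp df.
split; first by apply: filterS df' => y /(differentiable_comp (dp' y)).
move=> v; apply: near_eq_Ck (IH _ _ (cf (0, v))).
apply: filterS df' => y dfy.
have dc := differentiable_comp (dp' y) dfy.
by rewrite (deriveE _ dc) (diff_comp (dp' y) dfy) /= (deriveE _ dfy) diff_val.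
Qed.

Record chart (T E : Type) := Chart {
  cdom : set T;
  cfwd : T -> E;
  cbwd : E -> T }.

Section Charts.
Variables (R : realType).

Definition is_chart (T : topologicalType) (E : normedModType R) (c : chart T E)
    : Prop :=
  [/\ open (cdom c),
      open (cfwd c @` cdom c),
      (forall p, cdom c p -> cbwd c (cfwd c p) = p),
      (forall p, cdom c p -> {for p, continuous (cfwd c)}) &
      (forall p, cdom c p -> {for cfwd c p, continuous (cbwd c)})].

Definition line_chart (T : Type) (E : normedModType R) (c : chart T E)
    : chart (R * T) (R * E) :=
  Chart [set z | cdom c z.2] (fun z => (z.1, cfwd c z.2))
        (fun z => (z.1, cbwd c z.2)).

Definition line_atlas (T : Type) (E : normedModType R) (A : set (chart T E))
    : set (chart (R * T) (R * E)) :=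
  [set line_chart c | c in A].

Definition smooth_fun_at (T : Type) (E : normedModType R) (A : set (chart T E))
    (f : T -> R) (p : T) : Prop :=
  forall c, A c -> cdom c p -> smooth_at (f \o cbwd c) (cfwd c p).

(* The target is modelled on R^m, so smoothness in charts is tested on the
   coordinates. *)
Definition smooth_map_at (T N : topologicalType) (E : normedModType R) (m : nat)
    (A : set (chart T E)) (B : set (chart N 'rV[R]_m)) (F : T -> N) (p : T)
    : Prop :=
  {for p, continuous F} /\
  forall c d, A c -> B d -> cdom c p -> cdom d (F p) ->
    forall j, smooth_at (fun x => cfwd d (F (cbwd c x)) 0 j) (cfwd c p).

Lemma smooth_fun_comp (T N : topologicalType) (E : normedModType R) (m : nat)
    (A : set (chart T E)) (B : set (chart N 'rV[R]_m)) (F : T -> N) (p : T)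
    (f : N -> R) :
  (forall c, A c -> is_chart c) -> (forall d, B d -> is_chart d) ->
  (exists2 d, B d & cdom d (F p)) ->
  smooth_map_at A B F p -> smooth_fun_at B f (F p) ->
  smooth_fun_at A (f \o F) p.
Proof.
move=> hA hB [d Bd dF] [cF sF] sf c Ac cp k.
have [_ _ cK _ cb] := hA c Ac; have [od _ dK _ _] := hB d Bd.
have cFb : {for cfwd c p, continuous (F \o cbwd c)}.
  apply: (@continuous_comp _ _ _ (cbwd c) F); first exact: cb.
  by rewrite /= cK.
apply: (@near_eq_Ck _ _ k ((f \o cbwd d) \o (fun x => cfwd d (F (cbwd c x))))).
  have : \forall x \near cfwd c p, cdom d (F (cbwd c x)).
    by apply: cFb; apply: open_nbhs_nbhs; split => //=; rewrite cK.
  by apply: filterS => x /= /dK ->.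
apply: Ck_comp; first by rewrite cK //; exact: sf.
by move=> j; exact: sF.
Qed.

End Charts.

Record manifold (R : realType) (m : nat) := Manifold {
  carrier :> topologicalType;
  atlas : set (chart carrier 'rV[R]_m);
  manifold_hausdorff : hausdorff_space carrier;
  manifold_second_countable : @second_countable carrier;
  atlas_chart : forall c, atlas c -> is_chart c;
  atlas_cover : forall p : carrier, exists2 c, atlas c & cdom c p;
  atlas_compat : forall c d (p : carrier), atlas c -> atlas d ->
    cdom c p -> cdom d p ->
    forall j, smooth_at (fun x => cfwd d (cbwd c x) 0 j) (cfwd c p) }.

Arguments atlas {R m} P : rename.

Section SmoothFunctions.
Variables (R : realType) (m : nat) (P : manifold R m).

Definition smooth_fun (f : P -> R) : Prop :=
  forall p, smooth_fun_at (atlas P) f p.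

Definition smooth_pred : {pred (P -> R)} := [pred f | `[< smooth_fun f >]].

Lemma smooth_cst (a : R) : smooth_fun (cst a).
Proof. by move=> p c _ _ k; exact: Ck_cst. Qed.

Lemma smooth_add f g : smooth_fun f -> smooth_fun g -> smooth_fun (f + g).
Proof. by move=> sf sg p c Ac cp k; apply: CkD; [exact: sf|exact: sg]. Qed.

Lemma smooth_mul f g : smooth_fun f -> smooth_fun g -> smooth_fun (f * g).
Proof. by move=> sf sg p c Ac cp k; apply: CkM; [exact: sf|exact: sg]. Qed.

Lemma smooth_scale (a : R) f : smooth_fun f -> smooth_fun (a *: (f : P -> R^o)).
Proof. by move=> sf; have := smooth_mul (smooth_cst a) sf. Qed.

Lemma smooth_subring_closed : subring_closed smooth_pred.
Proof.
split=> [|f g|f g]; rewrite ?inE; first exact: (smooth_cst 1).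
- move=> sf sg; have -> : f - g = f + (-1 *: (g : P -> R^o) : P -> R).
    by apply/funext => x; rewrite /= scaleN1r.
  by apply: smooth_add => //; exact: smooth_scale.
- exact: smooth_mul.
Qed.

Record sfun := SFun { sf_val :> P -> R; _ : sf_val \in smooth_pred }.

HB.instance Definition _ := [isSub for sf_val].
HB.instance Definition _ := [Choice of sfun by <:].
HB.instance Definition _ :=
  GRing.SubChoice_isSubComPzRing.Build (P -> R) smooth_pred sfun
    smooth_subring_closed.

Lemma sfunP (f : sfun) : smooth_fun f.
Proof. by have := valP f; rewrite inE. Qed.

Definition mk_sfun (f : P -> R) (sf : smooth_fun f) : sfun :=
  SFun (introT (asboolP _) sf : f \in smooth_pred).

End SmoothFunctions.

Arguments sfunP {R m P} f p.

Section Tangent.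
Variables (R : realType) (m : nat) (P : manifold R m) (p : P).

Definition cst_sfun (a : R) : sfun P := mk_sfun (@smooth_cst R m P a).

(* Multiplication by [cst_sfun a] is scalar multiplication, so the first clause
   is R-linearity. *)
Definition is_derivation (v : sfun P -> R^o) : Prop :=
  (forall a f g, v (cst_sfun a * f + g) = a * v f + v g) /\
  (forall f g, v (f * g) = f p * v g + g p * v f).

Definition derivation_pred : {pred (sfun P -> R^o)} :=
  [pred v | `[< is_derivation v >]].

Lemma derivation_submod_closed : submod_closed derivation_pred.
Proof.
split=> [|a u v]; rewrite ?inE.
  have z h : (0 : sfun P -> R^o) h = 0 by [].
  by split=> *; rewrite !z !mulr0 addr0.
have e h : (a *: u + v) h = a * u h + v h by [].
move=> [uD uM] [vD vM]; split=> [b f g|f g]; rewrite !e.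
  by rewrite uD vD; ring.
by rewrite uM vM; ring.
Qed.

Record tangent := Tangent {
  tangent_val :> sfun P -> R^o; _ : tangent_val \in derivation_pred }.

HB.instance Definition _ := GRing.isSubmodClosed.Build R (sfun P -> R^o)
  derivation_pred derivation_submod_closed.
HB.instance Definition _ := [isSub for tangent_val].
HB.instance Definition _ := [Choice of tangent by <:].
HB.instance Definition _ := [SubChoice_isSubLmodule of tangent by <:].

Lemma tangentP (v : tangent) : is_derivation v.
Proof. by have := valP v; rewrite inE. Qed.

Definition mk_tangent (v : sfun P -> R^o) (dv : is_derivation v) : tangent :=
  Tangent (introT (asboolP _) dv : v \in derivation_pred).

End Tangent.

Record smooth_map (R : realType) (m n : nat) (P : manifold R m)
    (N : manifold R n) := SmoothMap {
  smooth_map_val :> P -> N;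
  smooth_mapP : forall p, smooth_map_at (atlas P) (atlas N) smooth_map_val p }.

Section Differential.
Variables (R : realType) (m n : nat) (P : manifold R m) (N : manifold R n).
Variable (F : smooth_map P N).

Lemma smooth_fun_pullback (f : sfun N) : smooth_fun (f \o F).
Proof.
move=> p; apply: (smooth_fun_comp _ _ _ (smooth_mapP F p) (sfunP f _)).
- exact: atlas_chart.
- exact: atlas_chart.
- exact: atlas_cover.
Qed.

Definition pullback_sfun (f : sfun N) : sfun P :=
  mk_sfun (smooth_fun_pullback f).

Lemma differential_derivation (p : P) (v : tangent p) :
  is_derivation (F p) (fun f => v (pullback_sfun f)).
Proof.
have [vD vM] := tangentP v; split=> [a f g|f g].
  by rewrite -vD; congr (v _); exact: val_inj.
rewrite (_ : pullback_sfun (f * g) = pullback_sfun f * pullback_sfun g).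
  by rewrite vM.
exact: val_inj.
Qed.

Definition differential (p : P) (v : tangent p) : tangent (F p) :=
  mk_tangent (differential_derivation v).

End Differential.

Definition vector_field (R : realType) (m : nat) (P : manifold R m) : Type :=
  forall p : P, tangent p.

Definition smooth_vf (R : realType) (m : nat) (P : manifold R m)
    (X : vector_field P) : Prop :=
  forall f : sfun P, smooth_fun (fun p => X p f).

Section Multilinear.
Variables (R : realType) (V : lmodType R).

Definition upd (k : nat) (v : 'I_k -> V) (i : 'I_k) (u : V) : 'I_k -> V :=
  fun j => if j == i then u else v j.

Definition multilinear (k : nat) (t : ('I_k -> V) -> R) : Prop :=
  forall v i a u w,
    t (upd v i (a *: u + w)) = a * t (upd v i u) + t (upd v i w).

Definition alternating (k : nat) (t : ('I_k -> V) -> R) : Prop :=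
  forall v i j, i != j -> v i = v j -> t v = 0.

(* Normalised so that, for one-forms, the wedge of a_1, ..., a_k evaluated on
   (v_1, ..., v_k) is the determinant of the matrix (a_i v_j). *)
Definition wedge (k l : nat) (s : ('I_k -> V) -> R) (t : ('I_l -> V) -> R)
    (v : 'I_(k + l) -> V) : R :=
  ((k`! * l`!)%N%:R)^-1 *
  \sum_(p : 'S_(k + l)) (-1) ^+ p *
    s (fun i => v (p (lshift l i))) * t (fun i => v (p (rshift k i))).

Definition is_basis (m : nat) (b : 'I_m -> V) : Prop :=
  forall v, exists! c : 'rV[R]_m, v = \sum_i c 0 i *: b i.

Definition gram (m : nat) (G : V -> V -> R) (b : 'I_m -> V) : 'M[R]_m :=
  \matrix_(i, j) G (b i) (b j).

(* (1/k!) G^{i_1 j_1} ... G^{i_k j_k} s_{i_1 ... i_k} t_{j_1 ... j_k}, in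
   components with respect to [b]; for alternating [s] and [t] this is the inner
   product for which that of decomposable forms is the determinant of the inner
   products of the factors. *)
Definition form_inner_in (m k : nat) (G : V -> V -> R) (b : 'I_m -> V)
    (s t : ('I_k -> V) -> R) : R :=
  (k`!%:R)^-1 *
  \sum_(I : {ffun 'I_k -> 'I_m}) \sum_(J : {ffun 'I_k -> 'I_m})
    (\prod_(a < k) invmx (gram G b) (I a) (J a)) *
    s (fun a => b (I a)) * t (fun a => b (J a)).

(* [form_inner_in] does not depend on the basis, so any basis will do. *)
Definition form_inner (m k : nat) (G : V -> V -> R) (s t : ('I_k -> V) -> R)
    : R :=
  form_inner_in G (xget (fun=> 0) [set b : 'I_m -> V | is_basis b]) s t.

End Multilinear.

Section Tensors.
Variables (R : realType) (m : nat) (P : manifold R m).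

Definition cotensor (k : nat) : Type :=
  forall p : P, ('I_k -> tangent p) -> R.

Definition is_tensor (k : nat) (t : cotensor k) : Prop :=
  (forall p, multilinear (t p)) /\
  (forall X : 'I_k -> vector_field P, (forall i, smooth_vf (X i)) ->
    smooth_fun (fun p => t p (fun i => X i p))).

Definition is_form (k : nat) (t : cotensor k) : Prop :=
  is_tensor t /\ (forall p, alternating (t p)).

Definition eval1 (t : cotensor 1) (p : P) (v : tangent p) : R :=
  t p (fun=> v).

Definition eval2 (t : cotensor 2) (p : P) (v w : tangent p) : R :=
  t p (fun i => if i == ord0 then v else w).

End Tensors.

Definition pullback (R : realType) (m n k : nat) (P : manifold R m)
    (N : manifold R n) (F : smooth_map P N) (t : cotensor N k) : cotensor P k :=
  fun p v => t (F p) (fun i => differential F (v i)).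

(* An orientation of a manifold is represented by a nowhere vanishing top-degree
   form, of which only the sign is used. *)
Definition orientation_form (R : realType) (m : nat) (M : manifold R m)
    (mu : cotensor M m) : Prop :=
  is_form mu /\ (forall x, exists v, mu x v != 0).

(* [act a] is only meaningful for [a != 0].  A local trivialisation over [U] is
   given by the fibre coordinate [tau] together with the inverse [sigma] of
   the map p |-> (tau p, proj p). *)
Record principal_bundle (R : realType) (n : nat) := PrincipalBundle {
  total :> manifold R n.+1;
  base : manifold R n;
  proj : smooth_map total base;
  act : R -> total -> total;
  act_smooth : forall a p, a != 0 ->
    smooth_map_at (line_atlas (atlas total)) (atlas total)
      (fun z : R * total => act z.1 z.2) (a, p);
  act1 : forall p, act 1 p = p;
  actM : forall a b p, a != 0 -> b != 0 -> act a (act b p) = act (a * b) p;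
  proj_act : forall a p, a != 0 -> proj (act a p) = proj p;
  local_triviality : forall x : base, exists (U : set base) (tau : total -> R)
      (sigma : R * base -> total),
    [/\ open U, U x,
        (forall p, U (proj p) ->
          [/\ smooth_fun_at (atlas total) tau p, tau p != 0,
              sigma (tau p, proj p) = p &
              forall a, a != 0 -> tau (act a p) = a * tau p]) &
        (forall t y, t != 0 -> U y ->
          [/\ smooth_map_at (line_atlas (atlas base)) (atlas total) sigma (t, y),
              proj (sigma (t, y)) = y & tau (sigma (t, y)) = t])] }.

Section Bundle.
Variables (R : realType) (n : nat) (P : principal_bundle R n).

Lemma act_smooth_map_at (a : R) (p : P) : a != 0 ->
  smooth_map_at (atlas P) (atlas P) (@act R n P a) p.
Proof.
move=> a0; have [ca sa] := act_smooth p a0; split.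
  apply: (@continuous_comp _ _ _ (fun p => (a, p)) (fun z => act z.1 z.2)) ca.
  apply: (@cvg_pair _ _ _ _ (nbhs a) (nbhs p)); first exact: cvg_cst.
  exact: cvg_id.
move=> c d Ac Ad cp dp j k.
apply: (@Ck_slice _ _ _ (fun z => cfwd d (act z.1 (cbwd c z.2)) 0 j)).
by apply: (sa (line_chart c) d) => //; exists c.
Qed.

Definition act_map (a : R) (a0 : a != 0) : smooth_map P P :=
  SmoothMap (fun p => act_smooth_map_at p a0).

Lemma expR_neq0 (s : R) : expR s != 0.
Proof. by rewrite gt_eqF ?expR_gt0. Qed.

(* The flow of the Euler vector field. *)
Definition flow (s : R) : smooth_map P P := act_map (expR_neq0 s).

Lemma line_atlas_chart (m : nat) (Q : manifold R m) c :
  line_atlas (atlas Q) c -> is_chart c.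
Proof.
move=> [d Ad <-]; have [od oi dK df db] := atlas_chart Ad; split=> /=.
- by apply: (@open_comp _ _ (snd : R * Q -> Q) (cdom d)) => // z _; exact: cvg_snd.
- rewrite (_ : _ @` _ = snd @^-1` (cfwd d @` cdom d)).
    by apply: open_comp oi => z _; exact: cvg_snd.
  apply/seteqP; split=> [_ [[s p] /= cp <-]|[s x] [p cp /= <-]] /=.
    by exists p.
  by exists (s, p).
- by move=> [s p] /= cp; rewrite dK.
- move=> [s p] /= cp; apply: (@cvg_pair _ _ _ _ (nbhs s) (nbhs (cfwd d p))).
    exact: cvg_fst.
  have h : {for (s, p), continuous (cfwd d \o (snd : R * Q -> Q))}.
    by apply: continuous_comp; [exact: cvg_snd|exact: df].
  exact: h.
- move=> [s p] /= cp.
  apply: (@cvg_pair _ _ _ _ (nbhs s) (nbhs (cbwd d (cfwd d p)))).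
    exact: cvg_fst.
  have h : {for (s, cfwd d p),
      continuous (cbwd d \o (snd : R * 'rV[R]_m -> 'rV[R]_m))}.
    by apply: continuous_comp; [exact: cvg_snd|exact: db].
  exact: h.
Qed.

Lemma derivable_flow (p : P) (f : sfun P) :
  derivable (fun s => f (flow s p)) 0 1.
Proof.
have [c Ac cp] := atlas_cover p.
have [_ _ cK _ _] := atlas_chart Ac.
have /= sf : smooth_fun_at (line_atlas (atlas P))
    (f \o (fun z : R * P => act z.1 z.2)) (1, p).
  apply: (smooth_fun_comp _ _ _ (act_smooth p (oner_neq0 R)) (sfunP f _)).
  - exact: line_atlas_chart.
  - exact: atlas_chart.
  - exact: atlas_cover.
have [||/nbhs_singleton df _] := sf (line_chart c) _ _ 1%N => //.
  by exists c.
rewrite /= -expR0 in df.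
apply/derivable1_diffP.
have dc : differentiable (fun s : R => (expR s, cfwd c p)) 0.
  apply: differentiable_pair; last exact: differentiable_cst.
  by apply/derivable1_diffP; exact: derivable_expR.
have := differentiable_comp dc df.
by rewrite /comp /= cK.
Qed.

Lemma euler_derivation (p : P) :
  is_derivation p (fun f => derive1 (fun s => f (flow s p)) 0).
Proof.
have f0 : flow 0 p = p by rewrite /= expR0 act1.
split=> [a f g|f g]; rewrite !derive1E.
  have df := @derivable_flow p f; have dg := @derivable_flow p g.
  transitivity ('D_1 (a *: (fun s => f (flow s p)) + (fun s => g (flow s p))) 0).
    by [].
  by rewrite deriveD ?deriveZ //; exact: derivableZ.
have df := @derivable_flow p f; have dg := @derivable_flow p g.
transitivity ('D_1 ((fun s => f (flow s p)) * (fun s => g (flow s p))) 0).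
  by [].
by rewrite deriveM // f0.
Qed.

(* The fundamental vector field of the action: the velocity at s = 0 of
   s |-> act (expR s) p. *)
Definition euler (p : P) : tangent p := mk_tangent (euler_derivation p).

Definition vertical (p : P) (v : tangent p) : Prop :=
  differential (proj P) v = 0.

(* The Lie derivative of [t] along the Euler vector field is the derivative at
   s = 0 of the pullback of [t] by its flow; for smooth [t] it always exists. *)
Definition lie_derivative_is (k : nat) (t t' : cotensor P k) : Prop :=
  forall (p : P) (v : 'I_k -> tangent p),
    is_derive (0 : R) (1 : R) (fun s : R => pullback (flow s) t v) (t' p v).

Definition homogeneous (k : nat) (lambda : R) (t : cotensor P k) : Prop :=
  lie_derivative_is t (fun p v => lambda * t p v).

Definition killing (g : cotensor P 2) : Prop :=
  lie_derivative_is g (fun p v => 0).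

Definition carrollian_metric (g : cotensor P 2) : Prop :=
  [/\ is_tensor g,
      (forall p (v w : tangent p), eval2 g v w = eval2 g w v),
      (forall p : P, exists b : 'I_n.+1 -> tangent p, is_basis b /\
        forall i j, eval2 g (b i) (b j) = ((i == j) && (i < n)%N)%:R) &
      (forall X : vector_field P, smooth_vf X ->
        ((forall Y : vector_field P, smooth_vf Y ->
            forall p, eval2 g (X p) (Y p) = 0) <->
         (forall p, vertical (X p))))].

Definition connection_form (theta : cotensor P 1) : Prop :=
  [/\ is_form theta,
      (forall p, eval1 theta (euler p) = 1) &
      (forall (a : R) (a0 : a != 0) (p : P) (v : 'I_1 -> tangent p),
        pullback (act_map a0) theta v = theta p v)].

Definition lorentz_metric (g : cotensor P 2) (theta : cotensor P 1) (p : P)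
    (v w : tangent p) : R :=
  eval2 g v w - eval1 theta v * eval1 theta w.

(* The orientation of [P]: the pullback of an orientation form of the base,
   followed by the connection form. *)
Definition total_orientation (mu : cotensor (base P) n) (theta : cotensor P 1)
    (p : P) (v : 'I_n.+1 -> tangent p) : R :=
  wedge (pullback (proj P) mu (p := p)) (theta p)
    (fun i => v (cast_ord (addn1 n) i)).

(* The top-degree form that takes the value 1 on positively oriented
   orthonormal frames. *)
Definition metric_volume (g : cotensor P 2) (theta : cotensor P 1)
    (mu : cotensor (base P) n) (p : P) (v : 'I_n.+1 -> tangent p) : R :=
  Num.sg (total_orientation mu theta v) *
  Num.sqrt `|\det (gram (lorentz_metric g theta (p := p)) v)|.

(* At most one [zeta] satisfies this: it is the Hodge star of [xi]. *)
Definition is_hodge_star (g : cotensor P 2) (theta : cotensor P 1)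
    (mu : cotensor (base P) n) (k l : nat) (kl : (k + l = n.+1)%N)
    (xi : cotensor P k) (zeta : cotensor P l) : Prop :=
  is_form zeta /\
  forall eta : cotensor P k, is_form eta ->
    forall (p : P) (v : 'I_n.+1 -> tangent p),
      wedge (eta p) (zeta p) (fun i => v (cast_ord kl i)) =
      form_inner n.+1 (lorentz_metric g theta (p := p)) (eta p) (xi p) *
      metric_volume g theta mu v.

End Bundle.

(* Main.v *)
From mathcomp Require Import all_boot all_order all_algebra fingroup perm.
From mathcomp Require Import all_classical all_reals all_analysis.
From mathcomp Require Import ring.
Require Import Defs.

Set Implicit Arguments.
Unset Strict Implicit.
Unset Printing Implicit Defensive.

Import Order.TTheory GRing.Theory Num.Theory.
Import numFieldNormedType.Exports.

Local Open Scope ring_scope.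

(* Let F_s be the flow of the Euler field.  A tensor is homogeneous of weight
   lambda iff F_s^* t = e^(lambda s) t for all s, so F_s preserves g (Killing),
   theta and the pullback of mu, hence the Lorentz metric and its volume form,
   and it scales xi by e^(lambda s).  Pulling the defining equation of the Hodge
   star back along F_s shows that F_s^* (star xi) and e^(lambda s) (star xi) have
   the same wedge product with every form df_1 /\ ... /\ df_k, and these
   products determine a form because differentials of global functions span the
   cotangent spaces. *)

(** * Multilinear and alternating forms, Gram matrices and change of basis *)

Section MultilinearAlgebra.
Variables (R : realType) (V : lmodType R).

Lemma upd_id (k : nat) (v : 'I_k -> V) i u : upd v i u i = u.
Proof. by rewrite /upd eqxx. Qed.

Lemma multilinear_sum (k : nat) (t : ('I_k -> V) -> R) (v : 'I_k -> V) i m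
    (c : 'I_m -> R) (b : 'I_m -> V) : multilinear t ->
  t (upd v i (\sum_j c j *: b j)) = \sum_j c j * t (upd v i (b j)).
Proof.
move=> tm; have t0 : t (upd v i 0) = 0.
  have /eqP := tm v i 1 0 0.
  by rewrite scale1r addr0 mul1r -subr_eq0 opprD addNKr oppr_eq0 => /eqP.
elim: m c b => [|m IH] c b; first by rewrite !big_ord0.
by rewrite !big_ord_recl tm IH.
Qed.

(** Induction on the number of slots: the first slot is expanded by linearity, and each resulting
    term is a multilinear form in the remaining slots. *)
Lemma multilinear_expand (k m : nat) (t : ('I_k -> V) -> R)
    (c : 'I_k -> 'I_m -> R) (b : 'I_m -> V) : multilinear t ->
  t (fun a => \sum_j c a j *: b j) =
  \sum_(I : {ffun 'I_k -> 'I_m}) (\prod_a c a (I a)) * t (fun a => b (I a)).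
Proof.
elim: k t c => [|k IH] t c tm.
  (* With no slots there is exactly one multi-index. It is built by eliminating ['I_0], since ['I_m]
     may be empty and offers no default value. *)
  rewrite (big_pred1
    [ffun x : 'I_0 => match x with Ordinal _ h => False_rect _ (notF h) end]).
    rewrite big_ord0 mul1r; congr t; apply/funext => -[] //.
  by move=> f; apply/esym/eqP/ffunP => -[].
pose cons i (f : 'I_k -> V) : 'I_k.+1 -> V :=
  fun a => if unlift ord0 a is Some a' then f a' else i.
have updc x f i u : upd (cons x f) (lift ord0 i) u = cons x (upd f i u).
  apply/funext => a; rewrite /upd /cons.
  by case: unliftP => [a' ->|->]; rewrite ?(inj_eq (lift_inj (h:=_))).
have upd0 x f u : upd (cons x f) ord0 u = cons u f.
  apply/funext => a; rewrite /upd /cons.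
  by case: unliftP => [a' ->|->]; rewrite ?eqxx.
(* [fc] is the bijection from pairs (first index, remaining indices) to multi-indices, along which
   the sum is reindexed. *)
pose fc (z : 'I_m * {ffun 'I_k -> 'I_m}) : {ffun 'I_k.+1 -> 'I_m} :=
  [ffun a => if unlift ord0 a is Some a' then z.2 a' else z.1].
have fc0 z : fc z ord0 = z.1 by rewrite ffunE unlift_none.
have fcS z i : fc z (lift ord0 i) = z.2 i by rewrite ffunE liftK.
rewrite (reindex fc) /=; last first.
  exists (fun f : {ffun 'I_k.+1 -> 'I_m} =>
            (f ord0, [ffun i => f (lift ord0 i)])) => [[i f] _|f _].
    by rewrite fc0; congr pair; apply/ffunP => j; rewrite ffunE fcS.
  by apply/ffunP => a; case: (unliftP ord0 a) => [a' ->|->];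
    rewrite ?fcS ?fc0 //= ffunE.
transitivity (t (upd (cons 0 (fun a => \sum_j c (lift ord0 a) j *: b j)) ord0
    (\sum_j c ord0 j *: b j))).
  rewrite upd0; congr t; apply/funext => a; rewrite /cons.
  by case: unliftP => [a' ->|->].
rewrite multilinear_sum // -(pair_bigA _ (fun i f =>
  (\prod_a c a (fc (i, f) a)) * t (fun a => b (fc (i, f) a)))) /=.
apply: eq_bigr => i _; rewrite upd0.
have tcm : multilinear (fun f => t (cons (b i) f)).
  by move=> v j a u w; rewrite -!updc tm.
rewrite (IH (fun f => t (cons (b i) f)) (fun a => c (lift ord0 a)) tcm).
rewrite big_distrr /=.
apply: eq_bigr => f _; rewrite big_ord_recl fc0 mulrA; congr (_ * _ * t _).
  by apply: eq_bigr => a _; rewrite fcS.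
apply/funext => a; rewrite /cons; case: unliftP => [a' ->|->].
  by rewrite fcS.
by rewrite fc0.
Qed.

Lemma alternating_tperm (k : nat) (t : ('I_k -> V) -> R) v i j :
  multilinear t -> alternating t -> i != j ->
  t (v \o tperm i j) = - t v.
Proof.
move=> tm ta ij; have ji : j == i = false by rewrite eq_sym (negPf ij).
pose h u w := upd (upd v i u) j w.
have hC u w : h u w = upd (upd v j w) i u.
  apply/funext => a; rewrite /h /upd.
  by case: (eqVneq a j) => [->|//]; rewrite ji.
have h0 u : t (h u u) = 0.
  by apply: (ta _ i j) => //; rewrite /h /upd eqxx (negPf ij) eqxx.
have hl u u' w : t (h (u + u') w) = t (h u w) + t (h u' w).
  by have := tm (upd v j w) i 1 u u'; rewrite scale1r mul1r !hC.
have hr u w w' : t (h u (w + w')) = t (h u w) + t (h u w').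
  by have := tm (upd v i u) j 1 w w'; rewrite scale1r mul1r.
(* Polarisation: putting [v i + v j] in both slots gives zero, and so do the two diagonal terms of
   its expansion; the two mixed terms are therefore opposite. *)
have /eqP := h0 (v i + v j).
rewrite hl !hr !h0 add0r addr0 addr_eq0 => /eqP e.
have -> : v = h (v i) (v j).
  apply/funext => a; rewrite /h /upd; case: eqVneq => [->//|_].
  by case: eqVneq => [->|].
rewrite e opprK; congr t; apply/funext => a; rewrite /h /upd /=.
by case: tpermP => [->|->|/eqP/negPf -> /eqP/negPf ->];
  rewrite ?eqxx ?(negPf ij) ?ji ?eqxx.
Qed.

Lemma alternating_perm (k : nat) (t : ('I_k -> V) -> R) v (s : 'S_k) :
  multilinear t -> alternating t -> t (v \o s) = (-1) ^+ s * t v.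
Proof.
move=> tm ta; have [ts -> dts] := prod_tpermP s.
elim: ts dts v => [_|[i j] ts IH /= /andP[ij dts]] v.
  rewrite big_nil odd_perm1 mul1r; congr t.
  by apply/funext => a /=; rewrite perm1.
rewrite big_cons odd_mul_tperm ij /=.
transitivity (t (v \o (\prod_(t0 <- ts) tperm t0.1 t0.2)%g \o tperm i j)).
  by congr t; apply/funext => a /=; rewrite permM.
rewrite alternating_tperm // IH //.
by case: odd_perm; rewrite ?expr0 ?expr1 ?mulN1r ?mul1r ?opprK.
Qed.

Definition bilinear_form (G : V -> V -> R) : Prop :=
  (forall a u u' w, G (a *: u + u') w = a * G u w + G u' w) /\
  (forall a u w w', G u (a *: w + w') = a * G u w + G u w').

Lemma linear_form_sum (f : V -> R) m (c : 'I_m -> R) (b : 'I_m -> V) :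
  (forall a u w, f (a *: u + w) = a * f u + f w) ->
  f (\sum_i c i *: b i) = \sum_i c i * f (b i).
Proof.
move=> fl; have f0 : f 0 = 0.
  have /eqP := fl 1 0 0.
  by rewrite scale1r addr0 mul1r -subr_eq0 opprD addNKr oppr_eq0 => /eqP.
elim: m c b => [|m IH] c b; first by rewrite !big_ord0.
by rewrite !big_ord_recl fl IH.
Qed.

Lemma gram_change (m : nat) (G : V -> V -> R) (b v : 'I_m -> V) (M : 'M[R]_m) :
  bilinear_form G -> (forall i, v i = \sum_j M i j *: b j) ->
  gram G v = M *m gram G b *m M^T.
Proof.
move=> [Gl Gr] vM; apply/matrixP => i j; rewrite mxE !vM.
rewrite (linear_form_sum _ _ (Gr^~ _)) mxE.
  apply: eq_bigr => l _; rewrite !mxE mulrC; congr (_ * _).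
  rewrite (@linear_form_sum (G^~ (b l))) //.
  by apply: eq_bigr => o _; rewrite mxE.
Qed.

(** The inverse Gram matrix transforms contragrediently to the components of the forms, so the
    transition matrices cancel. Invertibility of [M] and of the Gram matrix of [b] follows from that
    of the Gram matrix of [v]. *)
Lemma form_inner_in_change (m k : nat) (G : V -> V -> R) (b v : 'I_m -> V)
    (M : 'M[R]_m) (s t : ('I_k -> V) -> R) :
  bilinear_form G -> (forall i, v i = \sum_j M i j *: b j) ->
  \det (gram G v) != 0 -> multilinear s -> multilinear t ->
  form_inner_in G b s t = form_inner_in G v s t.
Proof.
move=> Gb vM dv sm tm; have e := gram_change Gb vM.
have uM : M \in unitmx.
  move: dv; rewrite unitmxE unitfE e !det_mulmx.
  by apply: contraNneq => ->; rewrite !mul0r.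
have ub : gram G b \in unitmx.
  move: dv; rewrite unitmxE unitfE e !det_mulmx.
  by apply: contraNneq => ->; rewrite mulr0 mul0r.
have uT : M^T \in unitmx by rewrite unitmx_tr.
have ei : invmx (gram G b) = M^T *m invmx (gram G v) *m M.
  have uv : gram G v \in unitmx by rewrite unitmxE unitfE.
  have h : (M^T *m invmx (gram G v) *m M) *m gram G b = 1%:M.
    apply: (can_inj (mulmxK uT)); rewrite mul1mx -!mulmxA [M *m (_ *m _)]mulmxA -e.
    by rewrite mulVmx // mulmx1.
  by rewrite -[LHS]mul1mx -h mulmxK.
rewrite /form_inner_in; congr (_ * _).
have ex u (um : multilinear u) (I : {ffun 'I_k -> 'I_m}) : u (fun a => v (I a)) =
    \sum_(K : {ffun 'I_k -> 'I_m}) (\prod_a M (I a) (K a)) * u (fun a => b (K a)).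
  rewrite -(multilinear_expand (fun a j => M (I a) j) b um).
  by congr u; apply/funext => a; rewrite vM.
(* Both sides become the fourfold sum of [T]: summing out [I] and [J] rebuilds the inverse Gram
   matrix of [b], summing out [K] and [L] rebuilds the values of [s] and [t] on [v]. *)
pose T (I J K L : {ffun 'I_k -> 'I_m}) :=
  (\prod_a (M (I a) (K a) * invmx (gram G v) (I a) (J a) * M (J a) (L a))) *
  (s (fun a => b (K a)) * t (fun a => b (L a))).
transitivity (\sum_K \sum_L \sum_I \sum_J T I J K L).
  apply: eq_bigr => K _; apply: eq_bigr => L _.
  rewrite -mulrA /T; under [RHS]eq_bigr do rewrite -big_distrl.
  rewrite -big_distrl /=; congr (_ * _).
  under eq_bigr => a _ do rewrite ei mxE.
  rewrite bigA_distr_bigA /= exchange_big /=; apply: eq_bigr => J _.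
  under eq_bigr => a _ do rewrite mxE big_distrl /=.
  rewrite bigA_distr_bigA /=; apply: eq_bigr => I _.
  by apply: eq_bigr => a _; rewrite mxE.
transitivity (\sum_I \sum_J \sum_K \sum_L T I J K L).
  under eq_bigr => K _ do rewrite exchange_big.
  rewrite exchange_big; apply: eq_bigr => I _ /=.
  under eq_bigr => K _ do rewrite exchange_big.
  by rewrite exchange_big.
apply: eq_bigr => I _; apply: eq_bigr => J _.
rewrite (ex s sm) (ex t tm) -mulrA big_distrlr /= big_distrr /=.
apply: eq_bigr => K _; rewrite big_distrr /=; apply: eq_bigr => L _.
rewrite /T !big_split /=; ring.
Qed.

End MultilinearAlgebra.

(** * Recovering a form from its wedge products *)

Lemma block_perm (R : comNzRingType) (k l : nat) (p : 'S_(k + l)) :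
  (forall a : 'I_k, (p (lshift l a) < k)%N) ->
  exists (pl : 'S_k) (pr : 'S_l),
    [/\ forall a, p (lshift l a) = lshift l (pl a),
        forall i, p (rshift k i) = rshift k (pr i) &
        (-1) ^+ p = (-1) ^+ pl * (-1) ^+ pr :> R].
Proof.
move=> bp; pose fl a := Ordinal (bp a).
have flE a : p (lshift l a) = lshift l (fl a) by exact: val_inj.
have fl_inj : injective fl.
  by move=> a a' e; apply/(@lshift_inj k l)/(@perm_inj _ p); rewrite !flE e.
have [fl' _ flK] := injF_bij fl_inj.
(* [p] already maps the first block onto itself, so by injectivity nothing from the second block can
   land there. *)
have rp i : exists j, p (rshift k i) = rshift k j.
  case: (split_ordP (p (rshift k i))) => j e; last by exists j.
  have /perm_inj/eqP : p (rshift k i) = p (lshift l (fl' j)) by rewrite flE flK.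
  by rewrite eq_rlshift.
have [fr frE] := choice rp.
have fr_inj : injective fr.
  by move=> a a' e; apply/(@rshift_inj k l)/(@perm_inj _ p); rewrite !frE e.
exists (perm fl_inj), (perm fr_inj); split=> [a|i|].
- by rewrite permE.
- by rewrite permE.
(* The sign is the determinant of the permutation matrix, which is block triangular. *)
rewrite -!det_perm -[perm_mx p]submxK.
have -> : ursubmx (perm_mx p) = 0 :> 'M[R]_(k, l).
  by apply/matrixP => a j; rewrite !mxE flE eq_lrshift.
rewrite det_lblock; congr (_ * _); congr (determinant _).
  by apply/matrixP => a j; rewrite !mxE flE permE eq_lshift.
by apply/matrixP => a j; rewrite !mxE frE permE eq_rshift.
Qed.

Section WedgePairing.
Variables (R : realType) (V : lmodType R).

(** By duality the determinant vanishes unless [p] preserves the first block. For such [p], the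
    determinant and the reordering of [t] produce the signs of the two block permutations, which
    cancel the sign of [p]; all surviving terms are equal. Their number is left as a cardinal
    because only its being nonzero matters later. *)
Lemma wedge_dual_det (k l m : nat) (b : 'I_m -> V) (alpha : 'I_m -> V -> R)
    (s : 'I_(k + l) -> 'I_m) (t : ('I_l -> V) -> R) :
  injective s -> (forall i j, alpha j (b i) = (i == j)%:R) ->
  multilinear t -> alternating t ->
  wedge (fun w : 'I_k -> V => \det (\matrix_(i, j) alpha (s (lshift l j)) (w i)))
    t (b \o s) =
  (k`! * l`!)%N%:R^-1 *
  #|[set p : 'S_(k + l) | [forall a : 'I_k, (p (lshift l a) < k)%N]]|%:R *
  t (fun i => b (s (rshift k i))).
Proof.
move=> s_inj dual tm ta; rewrite /wedge -mulrA; congr (_ * _).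
rewrite -sum1_card natr_sum big_distrl /= [RHS]big_mkcond /=.
apply: eq_bigr => p _; rewrite inE.
have -> : (\matrix_(i < k, j < k) alpha (s (lshift l j)) (b (s (p (lshift l i))))) =
    \matrix_(i, j) (p (lshift l i) == lshift l j)%:R.
  by apply/matrixP => i j; rewrite !mxE dual (inj_eq s_inj).
case: forallP => [bp|/forallP].
  have [pl [pr [plE prE ->]]] := block_perm R bp.
  have -> : \matrix_(i, j) (p (lshift l i) == lshift l j)%:R = perm_mx pl :> 'M[R]_k.
    by apply/matrixP => i j; rewrite !mxE plE eq_lshift.
  have -> : t (fun i => b (s (p (rshift k i)))) =
      (-1) ^+ pr * t (fun i => b (s (rshift k i))).
    rewrite -alternating_perm //; congr t.
    by apply/funext => i /=; rewrite prE.
  rewrite det_perm mul1r mulrA [_ * (-1) ^+ pl]mulrAC -!signr_addb addbb addFb.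
  by rewrite addbb mul1r.
rewrite negb_forall => /existsP [a na].
(* The index [a] is sent out of the first block, so row [a] is zero. *)
rewrite (expand_det_row _ a) big1 ?mulr0 ?mul0r // => j _.
rewrite mxE; case: eqP => [e|_]; last by rewrite mul0r.
by move: na; rewrite e /= ltn_ord.
Qed.

Lemma injective_complement (k l : nat) (J : 'I_l -> 'I_(k + l)) : injective J ->
  exists2 s : 'I_(k + l) -> 'I_(k + l),
    injective s & forall i, s (rshift k i) = J i.
Proof.
move=> Ji; pose C := ~: [set J i | i in 'I_l].
have cC : #|C| = k.
  by rewrite cardsCs finset.setCK card_imset // !card_ord addnK.
pose s (i : 'I_(k + l)) := match fintype.split i with
  | inl a => enum_val (cast_ord (esym cC) a) | inr i => J i end.
have sl a : s (lshift l a) = enum_val (cast_ord (esym cC) a).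
  by rewrite /s -/(unsplit (inl a)) unsplitK.
have sr i : s (rshift k i) = J i by rewrite /s -/(unsplit (inr i)) unsplitK.
exists s => // x y.
have nJ a i : enum_val (cast_ord (esym cC) a) <> J i.
  move=> e; have := enum_valP (cast_ord (esym cC) a).
  by rewrite e inE imset_f.
case: (split_ordP x) => [a ->|i ->]; case: (split_ordP y) => [a' ->|i' ->].
- by rewrite !sl => /enum_val_inj/cast_ord_inj ->.
- by rewrite sl sr => /nJ.
- by rewrite sl sr => /esym/nJ.
- by rewrite !sr => /Ji ->.
Qed.

(* Taking [I] to enumerate the complement of the image of [J], the wedge product
   on the frame [b] isolates the component of [t1] (and [t2]) at [b \o J]. *)
Lemma wedge_dual_det_inj (k l m : nat) (kl : (k + l)%N = m) (b : 'I_m -> V)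
    (alpha : 'I_m -> V -> R) (t1 t2 : ('I_l -> V) -> R) :
  (forall v, exists c : 'I_m -> R, v = \sum_i c i *: b i) ->
  (forall i j, alpha j (b i) = (i == j)%:R) ->
  multilinear t1 -> alternating t1 -> multilinear t2 -> alternating t2 ->
  (forall (I : 'I_k -> 'I_m) (v : 'I_m -> V),
    let eta := fun w : 'I_k -> V => \det (\matrix_(i, j) alpha (I j) (w i)) in
    wedge eta t1 (fun i => v (cast_ord kl i)) =
    wedge eta t2 (fun i => v (cast_ord kl i))) ->
  forall v, t1 v = t2 v.
Proof.
case: m / kl b alpha => b alpha sp dual t1m t1a t2m t2a w12 v.
have [c vc] := choice (fun i => sp (v i)).
have -> : v = (fun i => \sum_j c i j *: b j) by exact/funext.
rewrite !multilinear_expand //; apply: eq_bigr => J _; congr (_ * _).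
(* A repeated index makes both components vanish by alternation. *)
have [/injectiveP Ji|] := boolP (injectiveb J); last first.
  by case/injectivePn => i [j ij Jij]; rewrite (t1a _ i j) ?(t2a _ i j) ?Jij.
have [s s_inj sJ] := injective_complement Ji.
have := w12 (fun a => s (lshift l a)) (b \o s).
have -> : (fun i => (b \o s) (cast_ord erefl i)) = b \o s.
  by apply/funext => i /=; rewrite cast_ord_id.
rewrite /= !wedge_dual_det // => /mulfI.
have -> : (fun i => b (s (rshift k i))) = (fun a => b (J a)).
  by apply/funext => i; rewrite sJ.
apply; rewrite mulf_neq0 ?invr_eq0 ?pnatr_eq0 -?lt0n ?muln_gt0 ?fact_gt0 //.
(* The identity preserves the first block, so the common factor is nonzero and can be cancelled. *)
apply/card_gt0P; exists 1%g; rewrite inE; apply/forallP => a.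
by rewrite perm1 /= ltn_ord.
Qed.

End WedgePairing.

(** * Frames dual to differentials of global functions *)

Section DualFunctions.
Variables (R : realType) (m : nat) (P : manifold R m) (p : P).

Lemma tangent_sum (k : nat) (c : 'I_k -> R) (u : 'I_k -> tangent p) f :
  (\sum_i c i *: u i) f = \sum_i c i * u i f.
Proof.
exact: (@linear_form_sum _ _ (fun v : tangent p => v f)).
Qed.

Lemma tangent_eq (u v : tangent p) : (forall f, u f = v f) -> u = v.
Proof. by move=> uv; apply/val_inj/funext. Qed.

(* Tangent vectors are derivations of global functions, so global functions
   separate them and no cut-off argument is needed. *)
Lemma separating_functions (k r : nat) (b : 'I_k -> tangent p) :
  is_basis b -> (r <= k)%N ->
  exists f : 'I_r -> sfun P, row_free (\matrix_(j, i) b i (f j)).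
Proof.
move=> bb; elim: r => [_|r IH rk].
  by exists (fun=> 0); rewrite /row_free -leqn0 rank_leq_row.
have [f fr] := IH (ltnW rk); set M := \matrix_(j, i) _ in fr.
(* As [r < k], some nonzero combination of the [b i] is killed by every [f j]. It is a nonzero
   tangent vector, so some [h] detects it, and [h] is the function to add. *)
have : kermx M^T != 0.
  by rewrite -mxrank_eq0 mxrank_ker mxrank_tr (eqP fr) subn_eq0 -ltnNge.
case/rowV0Pn => c /sub_kermxP cM c0.
have [h ch] : exists h, \sum_i c 0 i * b i h != 0.
  apply: contrapT => /forallNP nh; move/eqP: c0; apply.
  have z : \sum_i c 0 i *: b i = 0.
    by apply: tangent_eq => h; rewrite tangent_sum; apply/eqP/negP => /negP /nh.
  have [c' [_ c'u]] := bb 0.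
  by rewrite -(c'u c) // (c'u 0) // big1 // => i _; rewrite mxE scale0r.
pose f' (j : 'I_r.+1) := if unlift ord0 j is Some j' then f j' else h.
have f'0 : f' ord0 = h by rewrite /f' unlift_none.
have f'S j : f' (lift ord0 j) = f j by rewrite /f' liftK.
exists f'; apply: inj_row_free => x xN.
have xNi i : x 0 ord0 * b i h + \sum_j x 0 (lift ord0 j) * b i (f j) = 0.
  have /rowP/(_ i) := xN; rewrite !mxE big_ord_recl !mxE f'0 => e; rewrite -[RHS]e.
  by congr (_ + _); apply: eq_bigr => j _; rewrite !mxE f'S.
(* Weighting the relations by [c] removes all the [f j] terms and leaves [x 0 ord0] times the
   nonzero number in [ch]. *)
have x0 : x 0 ord0 = 0.
  have : \sum_i c 0 i * (x 0 ord0 * b i h + \sum_j x 0 (lift ord0 j) * b i (f j)) = 0.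
    by rewrite big1 // => i _; rewrite xNi mulr0.
  under eq_bigr do rewrite mulrDr mulrCA.
  rewrite big_split -big_distrr /=.
  under [X in _ + X]eq_bigr do rewrite big_distrr /=.
  rewrite exchange_big /= [X in _ + X]big1 ?addr0 => [/eqP|j _].
    by rewrite mulf_eq0 (negPf ch) orbF => /eqP.
  under eq_bigr do rewrite mulrCA.
  rewrite -big_distrr /=; have /rowP/(_ j) := cM; rewrite !mxE => e.
  rewrite -[RHS](mulr0 (x 0 (lift ord0 j))) -[in RHS]e; congr (_ * _).
  by apply: eq_bigr => i _; rewrite !mxE.
have : (\row_j x 0 (lift ord0 j)) *m M = 0.
  apply/rowP => i; rewrite !mxE -[RHS](xNi i) x0 mul0r add0r.
  by apply: eq_bigr => j _; rewrite !mxE.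
move/eqP; rewrite (mulmx_free_eq0 _ fr) => /eqP/rowP x'0.
apply/rowP => j; rewrite mxE; case: (unliftP ord0 j) => [j' ->|-> //].
by have := x'0 j'; rewrite !mxE.
Qed.

(** With as many functions as basis vectors the matrix of values is square and invertible; its
    inverse turns [b] into the frame dual to the differentials. *)
Lemma dual_functions (k : nat) (b : 'I_k -> tangent p) : is_basis b ->
  exists (b' : 'I_k -> tangent p) (f : 'I_k -> sfun P),
    (forall v : tangent p, exists c : 'I_k -> R, v = \sum_i c i *: b' i) /\
    (forall i j, b' i (f j) = (i == j)%:R).
Proof.
move=> bb; have [f] := separating_functions bb (leqnn k).
set M := \matrix_(j, i) _ => fM.
have uM : M \in unitmx by rewrite -row_free_unit.
exists (fun i => \sum_j (invmx M) j i *: b j), f; split=> [v|i j].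
  have [c [-> _]] := bb v.
  exists (fun i => \sum_j M i j * c 0 j).
  transitivity (\sum_j (\sum_i \sum_a invmx M j i * M i a * c 0 a) *: b j).
    apply: eq_bigr => j _; congr (_ *: _); rewrite exchange_big /=.
    under eq_bigr do rewrite -big_distrl /=.
    have e a : \sum_i invmx M j i * M i a = (j == a)%:R.
      by have /matrixP/(_ j a) := mulVmx uM; rewrite !mxE.
    under eq_bigr do rewrite e mulr_natl mulrb eq_sym.
    by rewrite -big_mkcond big_pred1_eq.
  under eq_bigr do rewrite scaler_suml.
  rewrite exchange_big; apply: eq_bigr => i _.
  rewrite scaler_sumr; apply: eq_bigr => j _; rewrite scalerA; congr (_ *: _).
  by rewrite big_distrl; apply: eq_bigr => a _ /=; ring.
rewrite tangent_sum; have /matrixP/(_ j i) := mulmxV uM.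
rewrite !mxE eq_sym => <-; apply: eq_bigr => a _; by rewrite !mxE mulrC.
Qed.

End DualFunctions.

(** * Products of differentials, and pullbacks of cotensors *)

Section Cotensors.
Variables (R : realType) (m : nat) (P : manifold R m).

(** Tangent spaces at provably equal points are different types; comparing vectors through their
    action on functions avoids explicit casts. *)
Lemma cotensor_transport (k : nat) (t : cotensor P k) (p q : P)
    (v : 'I_k -> tangent p) (w : 'I_k -> tangent q) :
  p = q -> (forall i f, v i f = w i f) -> t p v = t q w.
Proof.
move=> pq; case: q / pq w => w vw; congr t; apply/funext => i.
exact/tangent_eq/vw.
Qed.

(** This is the wedge of the differentials of the [f j]. It is defined on all of [P], so it can
    serve as a test form in [is_hodge_star]. *)
Definition differential_product (k : nat) (f : 'I_k -> sfun P) : cotensor P k :=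
  fun p v => \det (\matrix_(i, j) (v i) (f j)).

Lemma smooth_fun_sum (I : finType) (h : I -> P -> R) :
  (forall i, smooth_fun (h i)) -> smooth_fun (\sum_i h i).
Proof.
move=> sh; elim/big_ind: _ => // [|f g]; last exact: smooth_add.
exact: smooth_cst.
Qed.

Lemma smooth_fun_prod (I : finType) (h : I -> P -> R) :
  (forall i, smooth_fun (h i)) -> smooth_fun (\prod_i h i).
Proof.
move=> sh; elim/big_ind: _ => // [|f g]; last exact: smooth_mul.
exact: smooth_cst.
Qed.

Lemma differential_product_form (k : nat) (f : 'I_k -> sfun P) :
  is_form (differential_product f).
Proof.
split; [split|] => [p v i a u w|X sX|p v i j ij vij].
- rewrite /differential_product.
  rewrite (@determinant_multilinear _ _ _ (\matrix_(i0, j) (upd v i u i0) (f j))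
    (\matrix_(i0, j) (upd v i w i0) (f j)) i a 1) ?mul1r //.
  + by apply/rowP => j; rewrite !mxE !upd_id mul1r.
  + by apply/matrixP => i0 j; rewrite !mxE /upd eq_sym (negPf (neq_lift _ _)).
  + by apply/matrixP => i0 j; rewrite !mxE /upd eq_sym (negPf (neq_lift _ _)).
- rewrite /differential_product.
  have -> : (fun p => \det (\matrix_(i, j) (X i p) (f j))) =
      \sum_(s : 'S_k) (cst ((-1) ^+ s) * \prod_i (fun p => X i p (f (s i)))).
    apply/funext => p; rewrite fct_sumE; apply: eq_bigr => s _.
    rewrite !fctE fct_prodE; congr (_ * _); apply: eq_bigr => i _.
    by rewrite mxE.
  apply: smooth_fun_sum => s; apply: smooth_mul; first exact: smooth_cst.
  by apply: smooth_fun_prod => i; exact: sX.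
- by apply: (determinant_alternate ij) => a; rewrite !mxE vij.
Qed.

End Cotensors.

Lemma differential_lin (R : realType) (m n : nat) (P : manifold R m)
    (N : manifold R n) (F : smooth_map P N) (p : P) a (u v : tangent p) :
  differential F (a *: u + v) = a *: differential F u + differential F v.
Proof. exact: tangent_eq. Qed.

Lemma pullback_multilinear (R : realType) (m n k : nat) (P : manifold R m)
    (N : manifold R n) (F : smooth_map P N) (t : cotensor N k) (p : P) :
  multilinear (t (F p)) -> multilinear (pullback F t (p := p)).
Proof.
move=> tm v i a u w; rewrite /pullback.
have dupd x : (fun j => differential F (upd v i x j)) =
    upd (fun j => differential F (v j)) i (differential F x).
  by apply/funext => j; rewrite /upd; case: eqP.
by rewrite !dupd differential_lin tm.
Qed.

Lemma pullback_alternating (R : realType) (m n k : nat) (P : manifold R m)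
    (N : manifold R n) (F : smooth_map P N) (t : cotensor N k) (p : P) :
  alternating (t (F p)) -> alternating (pullback F t (p := p)).
Proof. by move=> ta v i j ij vij; apply: (ta _ i j) => //; rewrite vij. Qed.

(** * Homogeneity along the flow of the Euler field *)

Lemma is_derive_expRM (R : realType) (lambda x : R) :
  is_derive x 1 (fun y => expR (lambda * y)) (lambda * expR (lambda * x)).
Proof.
rewrite mulrC; apply: (is_derive1_comp (f := expR)).
by have := is_deriveZ lambda (is_derive_id x 1); rewrite [_ *: 1]mulr1.
Qed.

Lemma linear_ode (R : realType) (lambda : R) (phi : R -> R) :
  (forall r : R, is_derive r 1 phi (lambda * phi r)) ->
  forall s, phi s = expR (lambda * s) * phi 0.
Proof.
move=> dphi s.
(* The integrating factor makes the derivative of [psi] vanish. *)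
pose psi := phi * (fun y => expR (- lambda * y)).
have cpsi x y : psi x = psi y.
  apply: is_derive_0_is_cst => z.
  have := is_deriveM (dphi z) (is_derive_expRM (- lambda) z).
  by congr is_derive; rewrite /GRing.scale /=; ring.
have := cpsi s 0; rewrite /psi !fctE mulr0 expR0 mulr1 => <-.
by rewrite mulrCA -expRD mulNr subrr expR0 mulr1.
Qed.

Section Flow.
Variables (R : realType) (n : nat) (P : principal_bundle R n).

Lemma flowD (s h : R) (p : P) : flow P (s + h) p = flow P h (flow P s p).
Proof. by rewrite /= actM ?expR_neq0 // expRD mulrC. Qed.

Lemma flow0 (p : P) : flow P 0 p = p.
Proof. by rewrite /= expR0 act1. Qed.

Lemma proj_flow (s : R) (p : P) : proj P (flow P s p) = proj P p.
Proof. by rewrite /= proj_act ?expR_neq0. Qed.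

Lemma pullback_flowD (k : nat) (t : cotensor P k) (s h : R) (p : P)
    (v : 'I_k -> tangent p) :
  pullback (flow P (s + h)) t v =
  pullback (flow P h) t (fun i => differential (flow P s) (v i)).
Proof.
rewrite /pullback; apply: (@cotensor_transport _ _ P) => [|i f]; first exact: flowD.
by congr (v i _); apply/val_inj/funext => q; exact: (congr1 f (flowD s h q)).
Qed.

Lemma pullback_flow0 (k : nat) (t : cotensor P k) (p : P)
    (v : 'I_k -> tangent p) : pullback (flow P 0) t v = t p v.
Proof.
rewrite /pullback; apply: (@cotensor_transport _ _ P) => [|i f]; first exact: flow0.
by rewrite /=; congr (v i _); apply/val_inj/funext => q; exact: (congr1 f (flow0 q)).
Qed.

(** Homogeneity only gives a derivative at time 0, but at every point. Applied at the point reached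
    at time [r], on pushed-forward vectors, the flow law turns it into a linear differential
    equation valid at all times. *)
Lemma homogeneous_flow (k : nat) (lambda : R) (t : cotensor P k) :
  homogeneous lambda t <->
  forall s (p : P) (v : 'I_k -> tangent p),
    pullback (flow P s) t v = expR (lambda * s) * t p v.
Proof.
split=> [ht s p v|ht p v].
  rewrite -(pullback_flow0 t v).
  apply: (@linear_ode _ lambda (fun s => pullback (flow P s) t v)) => r.
  have dh := ht _ (fun i => differential (flow P r) (v i)).
  rewrite (_ : (fun s => _) = (fun h => pullback (flow P h) t
      (fun i => differential (flow P r) (v i))) \o (fun x => x - r)); last first.
    by apply/funext => x /=; rewrite -pullback_flowD addrC subrK.
  rewrite -[lambda * _]mulr1; apply: is_derive1_comp.
    by rewrite subrr.
  by apply: is_derive_eq; rewrite subr0.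
have -> : (fun s => pullback (flow P s) t v) = fun s => expR (lambda * s) * t p v.
  by apply/funext => s; rewrite ht.
have := is_deriveM (is_derive_expRM lambda 0) (is_derive_cst (t p v) (0 : R) (1 : R)).
by rewrite scaler0 add0r mulr0 expR0 mulr1 [_ *: _]mulrC.
Qed.

Lemma eval2_bilinear (g : cotensor P 2) (p : P) :
  multilinear (g p) -> bilinear_form (eval2 g (p := p)).
Proof.
move=> gm.
have el (u w : tangent p) : eval2 g u w = g p (upd (fun=> w) ord0 u) by [].
have er (u w : tangent p) : eval2 g u w = g p (upd (fun=> u) ord_max w).
  congr (g p _); apply/funext => i; rewrite /upd.
  by case: i => -[|[]].
by split=> a u u' w; [rewrite !el gm|rewrite !er gm].
Qed.

Lemma lorentz_metric_bilinear (g : cotensor P 2) (theta : cotensor P 1) (p : P) :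
  multilinear (g p) -> multilinear (theta p) ->
  bilinear_form (lorentz_metric g theta (p := p)).
Proof.
move=> /eval2_bilinear[gl gr] tm; rewrite /lorentz_metric.
have tl a (u w : tangent p) :
    eval1 theta (a *: u + w) = a * eval1 theta u + eval1 theta w.
  have e (x : tangent p) : eval1 theta x = theta p (upd (fun=> 0) ord0 x).
    by congr (theta p _); apply/funext => i; rewrite /upd [i]ord1.
  by rewrite !e tm.
by split=> a u w x; rewrite ?gl ?gr tl; ring.
Qed.

(** * Invariance of the Lorentz metric and its volume form *)

Section Invariance.
Variables (g : cotensor P 2) (theta : cotensor P 1) (mu : cotensor (base P) n).
Hypotheses (hkilling : killing g) (htheta : connection_form theta).
Variables (s : R) (p : P).

Let push (v : tangent p) := differential (flow P s) v.

Lemma lorentz_metric_flow (u v : tangent p) :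
  lorentz_metric g theta (push u) (push v) = lorentz_metric g theta u v.
Proof.
(* Killing means homogeneous of weight 0, so the flow preserves [g] at all times. *)
have hg0 : homogeneous 0 g.
  by move=> q w; rewrite mul0r; exact: hkilling.
rewrite /lorentz_metric; congr (_ - _ * _).
- have := (homogeneous_flow _ _).1 hg0 s p (fun i => if i == ord0 then u else v).
  rewrite mul0r expR0 mul1r => e; rewrite -[RHS]e /pullback /eval2; congr (g _).
  by apply/funext => i; case: ifP.
- by have [_ _ /(_ _ (expR_neq0 s) p (fun=> u))] := htheta.
- by have [_ _ /(_ _ (expR_neq0 s) p (fun=> v))] := htheta.
Qed.

(** The flow covers the identity of the base, which fixes the pullback of [mu], and [theta] is
    invariant under the action. *)
Lemma total_orientation_flow (v : 'I_n.+1 -> tangent p) :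
  total_orientation mu theta (fun i => push (v i)) = total_orientation mu theta v.
Proof.
rewrite /total_orientation /wedge; congr (_ * _); apply: eq_bigr => q _.
congr (_ * _ * _).
  rewrite /pullback; apply: (@cotensor_transport _ _ (base P)) => [|i f].
    exact: proj_flow.
  rewrite /=; congr (v _ _); apply/val_inj/funext => x.
  exact: (congr1 f (proj_flow s x)).
have [_ _ h] := htheta.
exact: (h _ (expR_neq0 s) p (fun i => v (cast_ord (addn1 n) (q (rshift n i))))).
Qed.

Lemma gram_flow (v : 'I_n.+1 -> tangent p) :
  gram (lorentz_metric g theta (p := flow P s p)) (fun i => push (v i)) =
  gram (lorentz_metric g theta (p := p)) v.
Proof. by apply/matrixP => i j; rewrite !mxE lorentz_metric_flow. Qed.

Lemma metric_volume_flow (v : 'I_n.+1 -> tangent p) :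
  metric_volume g theta mu (fun i => push (v i)) = metric_volume g theta mu v.
Proof. by rewrite /metric_volume gram_flow total_orientation_flow. Qed.

End Invariance.

(* Where the frame [v] is degenerate for the Lorentz metric both sides vanish,
   so non-degeneracy of that metric is not needed. *)
Lemma form_inner_volume (g : cotensor P 2) (theta : cotensor P 1)
    (mu : cotensor (base P) n) (k : nat) (p : P) (xi eta : ('I_k -> tangent p) -> R)
    (v : 'I_n.+1 -> tangent p) :
  multilinear (g p) -> multilinear (theta p) ->
  (exists b : 'I_n.+1 -> tangent p, is_basis b) ->
  multilinear xi -> multilinear eta ->
  form_inner n.+1 (lorentz_metric g theta (p := p)) eta xi *
    metric_volume g theta mu v =
  form_inner_in (lorentz_metric g theta (p := p)) v eta xi *
    metric_volume g theta mu v.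
Proof.
move=> gm tm [b0 bb0] xm em; rewrite /metric_volume.
have [->|dv] := eqVneq (\det (gram (lorentz_metric g theta (p := p)) v)) 0.
  by rewrite normr0 sqrtr0 !mulr0.
congr (_ * _); rewrite /form_inner.
set b := xget _ _; have bb : is_basis b.
  apply: (@xgetPex _ (fun=> 0)
    [set b : 'I_n.+1 -> tangent p | is_basis b]%classic).
  by exists b0.
have [c vc] := choice (fun i => bb (v i)).
apply: (@form_inner_in_change _ _ _ _ _ _ _ (\matrix_(i, j) c i 0 j)) => //.
  exact: lorentz_metric_bilinear.
move=> i; have [-> _] := vc i; apply: eq_bigr => j _; by rewrite mxE.
Qed.

End Flow.

(** * Naturality of the Hodge star under the flow *)

Theorem proposition2p4 (R : realType) (n : nat) (P : principal_bundle R n)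
    (g : cotensor P 2) (theta : cotensor P 1) (mu : cotensor (base P) n)
    (hg : carrollian_metric g) (hkilling : killing g)
    (htheta : connection_form theta) (hmu : orientation_form mu)
    (k : nat) (hk : (k <= n.+1)%N) (lambda : R)
    (xi : cotensor P k) (star_xi : cotensor P (n.+1 - k))
    (hxi : is_form xi)
    (hstar : is_hodge_star g theta mu (subnKC hk) xi star_xi) :
  homogeneous lambda xi -> homogeneous lambda star_xi.
Proof.
move=> /homogeneous_flow xiE; apply/homogeneous_flow => s p.
have [[[gm _] _ gb _] [[[tm _] _] _ _]] := (hg, htheta).
have [[[[zm _] za] hodge] [[xm _] _]] := (hstar, hxi).
have basis (q : P) : exists b : 'I_n.+1 -> tangent q, is_basis b.
  by have [b []] := gb q; exists b.
have [b bb] := basis p; have [b' [f [b'span b'f]]] := dual_functions bb.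
apply: (wedge_dual_det_inj (kl := subnKC hk)
  (alpha := fun j (u : tangent p) => u (f j))
  (t1 := pullback (flow P s) star_xi (p := p))
  (t2 := fun v => expR (lambda * s) * star_xi p v) b'span b'f).

- exact: pullback_multilinear.
- exact: pullback_alternating.
- by move=> v i a u w; rewrite zm; ring.
- by move=> v i j ij vij; rewrite (za p v i j ij vij) mulr0.
move=> I v /=.
pose eta := differential_product (fun j => f (I j)).
(* Composing with the inverse flow gives a global form [eta'] whose pullback along the flow is
   [eta]; the Hodge equation can then be used at the point [flow P s p]. *)
pose f' j := pullback_sfun (flow P (- s)) (f (I j)).
pose eta' := differential_product f'.
have eta_pull w : eta p w = pullback (flow P s) eta' w.
  congr (\det _); apply/matrixP => i j; rewrite !mxE /=; congr (w i _).
  by apply/val_inj/funext => x; apply: (congr1 (f (I j)));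
    rewrite -flowD subrr flow0.
transitivity (wedge (eta' (flow P s p)) (star_xi (flow P s p))
    (fun i => differential (flow P s) (v (cast_ord (subnKC hk) i)))).
  rewrite /wedge; congr (_ * _); apply: eq_bigr => q _; congr (_ * _ * _).
  exact: eta_pull.
rewrite (hodge _ (differential_product_form _) _
  (fun i => differential (flow P s) (v i))).
have [[em' _] _] := differential_product_form f'.
have [[em _] _] := differential_product_form (fun j => f (I j)).
(* The bases chosen inside [form_inner] at the two points are unrelated. Passing to the frame [v] at
   [p] and to its pushforward at [flow P s p] gives equal Gram matrices. *)
rewrite form_inner_volume //.
transitivity (expR (lambda * s) *
    (form_inner_in (lorentz_metric g theta (p := p)) v (eta p) (xi p) *
     metric_volume g theta mu v)).
  rewrite metric_volume_flow // mulrA; congr (_ * _).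
  rewrite /form_inner_in gram_flow // mulrCA; congr (_ * _).
  (* Termwise, [eta'] on pushed vectors gives [eta], while [xi] contributes the factor
     [expR (lambda * s)]. *)
  rewrite big_distrr; apply: eq_bigr => K _ /=.
  rewrite big_distrr; apply: eq_bigr => L _ /=.
  by rewrite -!mulrA [RHS]mulrCA; congr (_ * _); rewrite [RHS]mulrCA eta_pull -xiE.
(* The Hodge equation at [p], read backwards, returns to a wedge product; the exponential factor
   then moves into its second argument. *)
rewrite -form_inner_volume // -(hodge _ (differential_product_form _)).
rewrite /wedge mulrCA; congr (_ * _); rewrite big_distrr; apply: eq_bigr => q _ /=.
by rewrite mulrCA.
Qed.
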